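(* Let $A=\{a_1<a_2<\dots<a_n<\dots\}$ be an infinite subset of $\mathbb{N}=\{1,2,\dots\}$. If $\overline{\varrho}(A)<1$, then $\tau(A)=0$.
   Context: For an infinite set $A=\{a_1<a_2<\dots<a_n<\dots\}\subseteq\mathbb{N}$, enumerated increasingly, the upper limit ratio is $\overline{\varrho}(A)=\limsup_{n\to\infty}\frac{a_n}{a_{n+1}}$. The exponent of convergence $\tau(A)\in[0,1]$ of $A$ is the number $\tau$ such that the series $\sum_{n=1}^\infty a_n^{-\sigma}$ converges for every real $\sigma>\tau$ and diverges for every real $\sigma<\tau$; equivalently, $\tau(A)=\limsup_{n\to\infty}\frac{\log n}{\log a_n}$. *)

(* Defs.v *)
From HB Require Import structures.
From mathcomp Require Import all_boot all_order all_algebra.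
From mathcomp Require Import all_classical all_reals all_analysis.
From mathcomp Require Import lra zify.

Set Implicit Arguments.
Unset Strict Implicit.
Unset Printing Implicit Defensive.

Import Order.TTheory GRing.Theory Num.Theory.
Import numFieldNormedType.Exports.

Local Open Scope classical_set_scope.
Local Open Scope ring_scope.

Definition is_increasing_enum (A : set nat) (a : nat -> nat) : Prop :=
  {homo a : m n / (m < n)%N} /\ range a = A.

(* The indexing starts at 0: [increasing_enum A n] is the element usually
   written a_(n+1), which affects neither the limit superior of the ratios nor
   the convergence of the series below.  The default value of [xget] is only
   taken when A is finite, see [increasing_enumP]. *)
Definition increasing_enum (A : set nat) : nat -> nat :=
  xget (fun=> 0%N) (is_increasing_enum A).

Definition upper_limit_ratio (R : realType) (A : set nat) : \bar R :=
  limn_esup (fun n =>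
    ((increasing_enum A n)%:R / (increasing_enum A n.+1)%:R)%:E).

Definition is_convergence_exponent (R : realType) (A : set nat) (tau : R) :
    Prop :=
  [/\ 0 <= tau <= 1,
      forall sigma : R, tau < sigma ->
        cvgn (series (fun n => (increasing_enum A n)%:R `^ (- sigma))) &
      forall sigma : R, sigma < tau ->
        ~ cvgn (series (fun n => (increasing_enum A n)%:R `^ (- sigma)))].

(* The default value -1 lies outside of [0, 1], and it is never taken for an
   infinite set of positive integers, see [convergence_exponentP]. *)
Definition convergence_exponent (R : realType) (A : set nat) : R :=
  xget (- 1) (@is_convergence_exponent R A).

Lemma increasing_enumP (A : set nat) :
  infinite_set A -> is_increasing_enum A (increasing_enum A).
Proof.
move=> Ainf; rewrite /increasing_enum; apply: xgetPex.
have nextP k : exists x, [/\ A x, (k <= x)%N &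
    forall y, A y -> (k <= y)%N -> (x <= y)%N].
  have ex : exists x, `[< A x /\ (k <= x)%N >].
    apply: contrapT => /forallNP noA; apply: Ainf.
    apply: (@sub_finite_set _ _ `I_k); last exact: finite_II.
    move=> x Ax /=; rewrite ltnNge; apply/negP => kx.
    by apply: (noA x); apply/asboolP.
  case: (ex_minnP ex) => x /asboolP[Ax kx] minx; exists x; split => // y Ay ky.
  by apply: minx; apply/asboolP.
have [f fP] := choice nextP.
pose a := fix a n := if n is m.+1 then f (a m).+1 else f 0%N.
have aA n : A (a n) by case: n => [|n] /=; [case: (fP 0%N)|case: (fP (a n).+1)].
have aS n : (a n < a n.+1)%N by rewrite /=; case: (fP (a n).+1).
have aI : {homo a : m n / (m < n)%N}.
  by apply: homo_ltn => //; exact: ltn_trans.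
exists a; split => //; apply/seteqP; split => [_ [n _ <-] //|x Ax].
have a_ge n : (n <= a n)%N.
  by elim: n => // n IH; apply: leq_ltn_trans IH _.
have hit n : (x <= a n)%N -> exists2 k, True & a k = x.
  elim: n => [|n IH] xa.
    exists 0%N => //; apply/eqP; rewrite eqn_leq xa andbT /=.
    by case: (fP 0%N) => _ _; apply.
  have [/IH //|ax] := leqP x (a n); exists n.+1 => //; apply/eqP.
  by rewrite eqn_leq xa andbT /=; case: (fP (a n).+1) => _ _; apply.
exact: (hit x (a_ge x)).
Qed.

Lemma is_convergence_exponent_unique (R : realType) (A : set nat) (s t : R) :
  is_convergence_exponent A s -> is_convergence_exponent A t -> s = t.
Proof.
move=> [_ cs ds] [_ ct dt].
have half u v : (forall x, u < x -> cvgn (series (fun n =>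
      (increasing_enum A n)%:R `^ (- x)))) ->
    (forall x, x < v -> ~ cvgn (series (fun n =>
      (increasing_enum A n)%:R `^ (- x)))) -> v <= u :> R.
  move=> c d; rewrite leNgt; apply/negP => uv.
  by apply: (d ((u + v) / 2)); [lra|apply: c; lra].
by apply/eqP; rewrite eq_le (half _ _ ct ds) (half _ _ cs dt).
Qed.

Lemma cvg_pseries (R : realType) (s : R) : 1 < s ->
  cvgn (series (fun n : nat => n.+1%:R `^ (- s) : R)).
Proof.
move=> s1; set u := fun n : nat => _.
have u0 n : 0 <= u n by rewrite powR_ge0.
have u_dec m n : (m <= n)%N -> u n <= u m.
  move=> mn; rewrite /u !powRN lef_pV2 ?posrE ?powR_gt0 ?ltr0n//.
  by apply: ge0_ler_powR; rewrite ?nnegrE ?ler_nat//; lra.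
set q : R := 2 * 2 `^ (- s).
have q1 : q < 1.
  have -> : q = 2 `^ (1 - s).
    by rewrite /q -{1}(powRr1 (ler0n R 2)) -powRD// pnatr_eq0 implybT.
  rewrite /powR pnatr_eq0 /= expR_lt1.
  have : 0 < ln 2 :> R by rewrite ln_gt0// ltr1n.
  by move=> l2; rewrite pmulr_llt0// subr_lt0.
have u2 i : u i.*2.+1 + u i.*2.+2 <= q * u i.
  have -> : q * u i = u i.*2.+1 + u i.*2.+1.
    have -> : u i.*2.+1 = 2 `^ (- s) * u i.
      by rewrite /u -powRM ?ler0n// -natrM mul2n.
    by rewrite /q; lra.
  by rewrite lerD2l u_dec.
have step m : series u m.*2.+1 <= 1 + q * series u m.
  rewrite /series/=; elim: m => [|m IH].
    by rewrite big_nat1 big_geq// mulr0 addr0 /u powR1.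
  rewrite doubleS big_nat_recr// (big_nat_recr m.*2.+1)//= (big_nat_recr m)//=.
  by have := u2 m; lra.
have bnd m : series u m <= (1 - q)^-1.
  have mono : series u m <= series u m.*2.+1.
    rewrite /series/= (@big_cat_nat _ _ _ m 0 m.*2.+1)//=; last by lia.
    by rewrite lerDl sumr_ge0.
  rewrite -[leRHS]mul1r ler_pdivlMr; last lra.
  by have := le_trans mono (step m); lra.
apply: nondecreasing_is_cvgn.
  by apply/nondecreasing_seqP => n; rewrite /series/= big_nat_recr//= lerDl.
by exists (1 - q)^-1 => _ [m _ <-].
Qed.

Lemma convergence_exponentP (R : realType) (A : set nat) :
  infinite_set A -> A `<=` [set n | (0 < n)%N] ->
  is_convergence_exponent A (convergence_exponent R A).
Proof.
move=> /increasing_enumP[]; set a := increasing_enum A => ai aA Apos.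
rewrite /convergence_exponent; apply: xgetPex.
have a_pos n : (0 < a n)%N by apply: Apos; rewrite -aA; exists n.
have a_ge n : (n < a n)%N.
  by elim: n => // n IH; apply: leq_ltn_trans IH _; exact: ai.
pose u (x : R) n : R := (a n)%:R `^ (- x).
have u0 x n : 0 <= u x n by rewrite powR_ge0.
have u_dec x y : x <= y -> cvgn (series (u x)) -> cvgn (series (u y)).
  move=> xy; apply: series_le_cvg => // n.
  by apply: ler_powR; rewrite ?lerN2// ler1n.
have u_cvg x : 1 < x -> cvgn (series (u x)).
  move=> x1; apply: (series_le_cvg _ _ _ (cvg_pseries x1)) => // n.
  rewrite /u !powRN lef_pV2 ?posrE ?powR_gt0 ?ltr0n//.
  by apply: ge0_ler_powR; rewrite ?nnegrE ?ler_nat//; lra.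
pose S := [set x : R | 0 <= x /\ cvgn (series (u x))].
have S2 : S 2 by split => //; apply: u_cvg; rewrite ltr1n.
have Slb : lbound S 0 by move=> x [].
have Sinf : has_inf S by split; [exists 2|exists 0].
exists (inf S); split; first (apply/andP; split).
- by apply: lb_le_inf => //; exists 2.
- rewrite leNgt; apply/negP => S1.
  have : inf S <= (1 + inf S) / 2.
    apply: ge_inf; first by exists 0.
    by split; [lra|apply: u_cvg; lra].
  by lra.
- move=> x Sx; have [y [_ cy] yx] := inf_lt Sinf.1 Sx.
  exact: (u_dec y x (ltW yx)).
- move=> x xS cx; have [x0|x0] := leP 0 x.
    have : inf S <= x by apply: ge_inf; [exists 0|split].
    by lra.
  have c0 : cvgn (series (u 0)) by apply: (u_dec x) => //; exact: ltW.
  have := cvg_series_cvg_0 c0.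
  have -> : u 0 = cst 1 by apply/funext => n; rewrite /u oppr0 powRr0.
  move=> /cvg_lim; rewrite lim_cst// => /(_ (@norm_hausdorff _ _)) /eqP.
  by rewrite oner_eq0.
Qed.

(* Main.v *)
Require Import Defs.
From mathcomp Require Import all_boot all_order all_algebra.
From mathcomp Require Import all_classical all_reals all_analysis.
From mathcomp Require Import ring lra.

(** If the limit superior of [a_n / a_(n+1)] is below 1, then some [q < 1]
    bounds these ratios from a certain index on, so [a_n] grows at least
    geometrically. For [sigma > 0] the terms [a_n ^ (- sigma)] are positive and
    have consecutive quotients [(a_n / a_(n+1)) ^ sigma <= q ^ sigma < 1]; by
    the ratio test their series converges. Since the series diverges for every
    [sigma] below the exponent of convergence, and that exponent is
    nonnegative, it is 0.

    [limn_esup_lt_near] provides the bound [q], [ratio_test] is d'Alembert's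
    criterion, and [cvg_series_powRN] applies it to the powers [a_n ^ (- sigma)]. *)

Import Order.TTheory GRing.Theory Num.Theory.
Import numFieldNormedType.Exports.

Local Open Scope classical_set_scope.
Local Open Scope ring_scope.

(** A limit superior is an infimum of suprema over tails: if it is below [l],
    then so is the supremum [q] over one of the tails. *)
Lemma limn_esup_lt_near (R : realType) (u : nat -> R) (l : R) :
  (limn_esup (fun n => (u n)%:E) < l%:E)%E ->
  exists2 q, q < l & \forall n \near \oo, u n <= q.
Proof.
move=> /ereal_inf_lt[_ [V Voo <-]].
case supE: (ereal_sup _) => [q| |] // ql.
  exists q; first by rewrite -lte_fin.
  apply: filterS Voo => n Vn.
  by rewrite -lee_fin -supE; apply: ereal_sup_ubound; exists n.
(* The supremum over V cannot be -oo, because V is nonempty. *)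
have [n Vn] := filter_ex Voo.
suff : ((u n)%:E <= -oo)%E by [].
by rewrite -supE; apply: ereal_sup_ubound; exists n.
Qed.

(** With [S m] the [m]-th partial sum, [S m + u m / (1 - q)] eventually
    decreases: the second term is the total mass of a geometric series of
    ratio [q] starting at [u m], so it majorizes what is left to sum. The
    partial sums are therefore bounded. *)
Lemma ratio_test (R : realType) (u : nat -> R) (q : R) :
    (forall n, 0 <= u n) -> q < 1 ->
    (\forall n \near \oo, u n.+1 <= q * u n) ->
  cvgn (series u).
Proof.
move=> u0 q1 [N _ uq].
pose T m := series u m + u m / (1 - q).
have T_dec k : T (k + N)%N <= T N.
  elim: k => // k; apply: le_trans; rewrite addSn /T seriesSr -addrA lerD2l.
  rewrite -[leRHS](_ : u (k + N)%N + q * u (k + N)%N / (1 - q) = _); last first.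
    by field; lra.
  rewrite lerD2l ler_wpM2r ?invr_ge0//; first lra.
  by apply: uq; rewrite /= leq_addl.
have S_mono : nondecreasing_seq (series u).
  by apply/nondecreasing_seqP => n; rewrite seriesSr lerDl.
apply: nondecreasing_is_cvgn => //; exists (T N) => _ [m _ <-].
apply: le_trans (S_mono _ _ (leq_addr N m)) (le_trans _ (T_dec m)).
by rewrite lerDl divr_ge0//; lra.
Qed.

Lemma cvg_series_powRN (R : realType) (a : nat -> R) (q sigma : R) :
    (forall n, 0 < a n) -> q < 1 -> 0 < sigma ->
    (\forall n \near \oo, a n / a n.+1 <= q) ->
  cvgn (series (fun n => a n `^ (- sigma))).
Proof.
move=> a0 q1 s0 aq.
have q0 : 0 <= q.
  have [n] := filter_ex aq; apply: le_trans.
  by rewrite divr_ge0// ltW.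
apply: (@ratio_test _ _ (q `^ sigma)) => [n||].
- exact: powR_ge0.
- rewrite -[ltRHS](_ : 1 `^ sigma = 1); last by rewrite powR1.
  by rewrite gt0_ltr_powR ?nnegrE.
- apply: filterS aq => n aq.
  have -> : a n.+1 `^ (- sigma) = (a n / a n.+1) `^ sigma * a n `^ (- sigma).
    rewrite powRM ?invr_ge0 ?(ltW (a0 _))// -powR_inv1 ?(ltW (a0 _))//.
    rewrite -powRrM mulN1r mulrAC (powRN (a n)) divff ?mul1r//.
    by rewrite gt_eqF// powR_gt0.
  rewrite ler_wpM2r ?powR_ge0// ge0_ler_powR ?nnegrE ?(ltW s0)//.
  by rewrite divr_ge0// ltW.
Qed.

Theorem proposition2p3 (R : realType) (A : set nat)
    (Apos : A `<=` [set n | (0 < n)%N]) (Ainf : infinite_set A) :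
  (upper_limit_ratio R A < 1)%E -> convergence_exponent R A = 0.
Proof.
move=> /limn_esup_lt_near[q q1 aq].
have [_ aA] := increasing_enumP Ainf.
have a0 n : 0 < (increasing_enum A n)%:R :> R.
  by rewrite ltr0n; apply: Apos; rewrite -[X in X _]aA; exists n.
have [/andP[tau0 _] _ div] := convergence_exponentP R Ainf Apos.
apply/eqP; rewrite eq_le tau0 andbT leNgt; apply/negP => tau_gt0.
apply: (div (convergence_exponent R A / 2)); first by lra.
by apply: (cvg_series_powRN _ _ _ _ a0 q1 _ aq); rewrite divr_gt0.
Qed.
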